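(* Let $V$ be an $n$-dimensional complex vector space with basis $e_1,\ldots,e_n$ and dual basis $e_1^*,\ldots,e_n^*$. Let $a_{ij}=e_i\otimes e_j-e_j\otimes e_i\in\Lambda_2(V)$ and $b_{ij}=e_i^*\otimes e_j^*+e_j^*\otimes e_i^*\in S_2(V^* )$, and let $A=(a_{ij})_{1\le i,j\le n}$, $B=(b_{ij})_{1\le i,j\le n}\in\operatorname{Mat}_{n,n}(\Lambda(\Lambda_2(V)\oplus S_2(V^* )))$. Then $(AB)^{n-1}A=0$.
   Context: $\Lambda(\Lambda_2(V)\oplus S_2(V^* ))$ is the exterior algebra on $\Lambda_2(V)\oplus S_2(V^* )$; the $a_{ij}$ and $b_{ij}$ are elements of degree one in it (so they pairwise anticommute), with $a_{ji}=-a_{ij}$ and $b_{ji}=b_{ij}$. Matrix products are taken with entries multiplied in the order written; $(AB)^0$ is the identity matrix. *)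

(* Defs.v *)
From HB Require Import structures.
From mathcomp Require Import all_boot all_order all_algebra.
From mathcomp Require Import complex.
From mathcomp Require Import Rstruct.
Set Implicit Arguments. Unset Strict Implicit. Unset Printing Implicit Defensive.
Import Order.TTheory GRing.Theory Num.Theory.
Local Open Scope ring_scope.

Definition CC := (Rdefinitions.R)[i].

(* An element of Lambda(W), W with basis indexed by the finite type T, is given by
   its coordinates on the basis e_S = e_{s1} /\ ... /\ e_{sk} (s1 < ... < sk in the
   order of T given by enum_rank), S ranging over subsets of T. *)
Definition ext (T : finType) := {ffun {set T} -> CC}.

(* sign of e_A /\ e_B = sign * e_(A u B) for disjoint A, B: (-1)^(#inversions) *)
Definition ext_sign (T : finType) (A B : {set T}) : CC :=
  (-1) ^+ #|[set p : T * T | [&& p.1 \in A, p.2 \in B & (enum_rank p.2 < enum_rank p.1)%N]]|.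

Definition emul (T : finType) (f g : ext T) : ext T :=
  [ffun S : {set T} => \sum_(A : {set T} | A \subset S) ext_sign A (S :\: A) * f A * g (S :\: A)].

Definition eone (T : finType) : ext T := [ffun S : {set T} => (S == set0)%:R].

Definition egen (T : finType) (t : T) : ext T := [ffun S : {set T} => (S == [set t])%:R].

Definition emulmx (T : finType) (n : nat) (M N : 'M[ext T]_n) : 'M[ext T]_n :=
  \matrix_(i, j) \sum_(k < n) emul (M i k) (N k j).

Definition eidmx (T : finType) (n : nat) : 'M[ext T]_n :=
  \matrix_(i, j) (if i == j then eone T else 0).

Definition epowmx (T : finType) (n : nat) (M : 'M[ext T]_n) (k : nat) : 'M[ext T]_n :=
  iter k (emulmx M) (eidmx T n).

(* Basis of Lambda_2(V): a_ij = e_i(x)e_j - e_j(x)e_i for i < j.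
   Basis of S_2(V^* ): e_i^*(x)e_j^* + e_j^*(x)e_i^* for i < j, and e_i^*(x)e_i^*
   (so that b_ii = 2 e_i^*(x)e_i^* ). *)
Definition Lam2idx (n : nat) := {p : 'I_n * 'I_n | (p.1 < p.2)%N}.
Definition Sym2idx (n : nat) := {p : 'I_n * 'I_n | (p.1 <= p.2)%N}.
Definition Widx (n : nat) : finType := (Lam2idx n + Sym2idx n)%type.

Definition a_entry (n : nat) (i j : 'I_n) : ext (Widx n) :=
  match ltnP i j with
  | LtnNotGeq hij => egen (inl (exist _ (i, j) hij : Lam2idx n))
  | GeqNotLtn hji =>
      match ltnP j i with
      | LtnNotGeq hji' => - egen (inl (exist _ (j, i) hji' : Lam2idx n))
      | GeqNotLtn _ => 0
      end
  end.

Definition b_entry (n : nat) (i j : 'I_n) : ext (Widx n) :=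
  match leqP i j with
  | LeqNotGtn hij =>
      if i == j then 2%:R *: egen (inr (exist _ (i, j) hij : Sym2idx n))
      else egen (inr (exist _ (i, j) hij : Sym2idx n))
  | GtnNotLeq hji => egen (inr (exist _ (j, i) (ltnW hji) : Sym2idx n))
  end.

Definition Amx (n : nat) : 'M[ext (Widx n)]_n := \matrix_(i, j) a_entry i j.
Definition Bmx (n : nat) : 'M[ext (Widx n)]_n := \matrix_(i, j) b_entry i j.

(* Main.v *)
(** The entries of [X = AB] are even, hence commute.  Reversing a word of three odd
    factors changes its sign, so every [P_k = X^k A] is skew-symmetric; as [B] is
    symmetric, [tr X^(k+1) = tr (P_k B) = 0], and therefore the characteristic
    polynomial of [X] is [t^N] ([N] the size of the matrices) and
    [adj (t - X) = sum_k t^k X^(N-1-k)].  The 2x2 minors of an adjugate are multiples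
    of the determinant, here [t^N], so their coefficients of degree [N-1] vanish:
    [sum_i (X^(N-1-i))_pr (X^i)_sq] is symmetric in [p] and [s].  Multiplying by [A_rq]
    and summing over [r] and [q] turns this into [N (P_(N-1))_ps = N (P_(N-1))_sp],
    while [P_(N-1)] is skew-symmetric; hence [P_(N-1) = 0]. *)
From HB Require Import structures.
Require Import Defs.
From mathcomp Require Import all_boot all_order all_algebra complex Rstruct zify.
From mathcomp Require Import perm.
Set Implicit Arguments. Unset Strict Implicit. Unset Printing Implicit Defensive.
Import Order.TTheory GRing.Theory Num.Theory.
Local Open Scope ring_scope.

(** * Matrices over a commutative ring *)

(* Comparing [M] with [M + E_rp] shows that the quotient is an entry of
   [\adj (M + E_rp) - \adj M]. *)
Lemma adj_minor2 (R : comPzRingType) n (M : 'M[R]_n) p r s q :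
  exists z, \adj M p r * \adj M s q - \adj M s r * \adj M p q = \det M * z.
Proof.
pose M1 := M + delta_mx r p.
(* [M1] differs from [M] in row [r] only, and cofactors along row [r] do not see that row. *)
have cof j : cofactor M1 r j = cofactor M r j.
  rewrite !expand_cofactor; apply: eq_bigr => t _; congr (_ * _).
  by apply: eq_bigr => k rk; rewrite !mxE eq_sym (negPf rk) addr0.
have det1 : \det M1 = \det M + \adj M p r.
  rewrite (expand_det_row M1 r) (expand_det_row M r).
  under eq_bigr do rewrite cof !mxE eqxx mulrDl.
  rewrite big_split /=; congr (_ + _); rewrite (bigD1 p) //= big1 => [|j jp].
    by rewrite eqxx mul1r addr0 mxE.
  by rewrite (negPf jp) mul0r.
(* The product [\adj M1 *m M1 *m \adj M] is evaluated in two ways; the claim is the entry [(s, q)]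
   of the result. *)
have key : \det M *: \adj M1 + (\adj M1 *m delta_mx r p) *m \adj M =
    \det M1 *: \adj M.
  rewrite -mul_scalar_mx -scalar_mxC -mul_mx_adj mulmxA -mulmxDl -mulmxDr.
  by rewrite mul_adj_mx mul_scalar_mx.
have e : (\adj M1 *m delta_mx r p *m \adj M) s q = \adj M s r * \adj M p q.
  rewrite mxE (bigD1 p) //= big1 => [|j jp].
    rewrite addr0 mxE (bigD1 r) //= big1 => [|j jr].
      by rewrite addr0 [delta_mx _ _ _ _]mxE !eqxx mulr1 !mxE cof.
    by rewrite [delta_mx _ _ _ _]mxE (negPf jr) mulr0.
  rewrite mxE big1 ?mul0r // => k _.
  by rewrite [delta_mx _ _ _ _]mxE (negPf jp) andbF mulr0.
exists (\adj M1 s q - \adj M s q).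
move/matrixP/(_ s q): key; rewrite [LHS]mxE e [X in X + _]mxE [RHS]mxE det1.
rewrite mulrDl mulrBr => h.
by apply/eqP; rewrite subr_eq addrAC h addrAC subrr add0r.
Qed.

(** * Characteristic polynomials of matrices whose powers are traceless *)

Section Commutative.
Variable R : comNzRingType.

Lemma deriv_prod (I : finType) (F : I -> {poly R}) :
  (\prod_i F i)^`() = \sum_i (F i)^`() * \prod_(j | i != j) F j.
Proof.
(* The induction runs over duplicate-free lists, since the condition [i != j] must remove exactly
   one factor. *)
suff H r : uniq r -> (\prod_(i <- r) F i)^`() =
    \sum_(i <- r) (F i)^`() * \prod_(j <- r | i != j) F j.
  by rewrite H ?index_enum_uniq.
elim: r => [|i r IH] /=; first by rewrite !big_nil -[1]/(1%:P) derivC.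
case/andP=> ir ur; rewrite big_cons derivM IH // [in RHS]big_cons.
congr (_ * _ + _).
  rewrite big_cons eqxx /=; rewrite [LHS]big_seq_cond [RHS]big_seq_cond.
  apply: eq_bigl => j; case jr: (j \in r) => //=.
  by symmetry; apply: contraNneq ir => ->.
rewrite mulr_sumr big_seq [RHS]big_seq; apply: eq_bigr => j jr.
rewrite big_cons ifT; first by rewrite mulrCA.
by apply: contraNneq ir => <-.
Qed.

(** Jacobi's formula: differentiate the Leibniz expansion factor by factor, then group the
    permutations by their value at [i]; each group sums to a cofactor. *)
Lemma deriv_det n (M : 'M[{poly R}]_n) :
  (\det M)^`() = \sum_i \sum_j (M i j)^`() * cofactor M i j.
Proof.
rewrite /determinant raddf_sum /=.
transitivity (\sum_(s : {perm 'I_n}) \sum_i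
  (M i (s i))^`() * ((-1) ^+ s * \prod_(k | i != k) M k (s k))).
  apply: eq_bigr => s _.
  have -> p : ((-1) ^+ s * p)^`() = (-1) ^+ s * p^`() :> {poly R}.
    by rewrite !mulr_sign; case: (odd_perm s); rewrite ?derivN.
  by rewrite deriv_prod mulr_sumr; apply: eq_bigr => i _; rewrite mulrCA.
rewrite exchange_big; apply: eq_bigr => i _ /=.
rewrite (partition_big (fun s : {perm 'I_n} => s i) predT) //=.
apply: eq_bigr => j _; rewrite expand_cofactor mulr_sumr.
by apply: eq_bigr => s /eqP ->.
Qed.

Lemma deriv_char_poly n (X : 'M[R]_n) :
  (char_poly X)^`() = \tr (\adj (char_poly_mx X)).
Proof.
rewrite deriv_det; apply: eq_bigr => i _; rewrite (bigD1 i) //= big1 => [|j ji].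
  by rewrite !mxE eqxx derivB derivX derivC subr0 mul1r addr0.
by rewrite !mxE eq_sym (negPf ji) sub0r derivN derivC oppr0 mul0r.
Qed.

(** Comparison of coefficients in [adj (t - X) (t - X) = det (t - X)]. *)
Lemma adj_char_poly_mx_coef n (X : 'M[R]_n) :
  let D := fun k => \matrix_(i, j) (\adj (char_poly_mx X) i j)`_k in
  (forall k, D k - D k.+1 *m X = ((char_poly X)`_k.+1)%:M)
  /\ - (D 0 *m X) = ((char_poly X)`_0)%:M.
Proof.
move=> D.
have H m i j : ((\det (char_poly_mx X))%:M i j)`_m =
   (\adj (char_poly_mx X) i j * 'X)`_m - (D m *m X) i j.
  rewrite -mul_adj_mx mxE coef_sum.
  transitivity (\sum_l ((\adj (char_poly_mx X) i l * ('X *+ (l == j)))`_m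
                  - D m i l * X l j)).
    by apply: eq_bigr => l _; rewrite !mxE mulrBr coefB coefMC.
  rewrite sumrB [(D m *m X) i j]mxE; congr (_ - _).
  rewrite (bigD1 j) //= eqxx big1 ?addr0 ?mulr1n // => l /negPf ->.
  by rewrite mulr0n mulr0 coef0.
split=> [k|]; apply/matrixP => i j.
  have := H k.+1 i j; rewrite coefMX /= [in LHS]mxE coefMn => h.
  by rewrite !mxE h !mxE.
have := H 0%N i j; rewrite coefMX /= [in LHS]mxE coefMn sub0r => h.
by rewrite !mxE h !mxE.
Qed.

Hypothesis R_torsion_free : forall (x : R) k, x *+ k.+1 = 0 -> x = 0.

(** The Faddeev-LeVerrier recursion, run downwards from the top degree. The trace of [D k] is known
    twice: from the derivative of the characteristic polynomial, and from the recursion, where the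
    power of [X] contributes nothing. The two values differ by a nonzero integer multiple of
    [c_(k+1)], which therefore vanishes. *)
Lemma adj_char_poly_mx_traceless n (X : 'M[R]_n.+1)
    (trX : forall k, \tr (X ^+ k.+1) = 0) :
  char_poly X = 'X^(n.+1) /\
  forall k i j, (k <= n)%N ->
    (\adj (char_poly_mx X) i j)`_k = (X ^+ (n - k)) i j.
Proof.
set c := char_poly X; set D' := \adj _.
pose D k := \matrix_(i, j) (D' i j)`_k.
have [E E0] : (forall k, D k - D k.+1 *m X = (c`_k.+1)%:M) /\
    - (D 0%N *m X) = (c`_0)%:M := adj_char_poly_mx_coef X.
have szc : size c = n.+2 by rewrite size_char_poly.
have c_lead : c`_n.+1 = 1.
  by have /monicP := char_poly_monic X; rewrite lead_coefE -/c szc.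
have E' k : D k = D k.+1 *m X + (c`_k.+1)%:M by rewrite -E addrC subrK.
(* The coefficients vanish beyond the largest size [m] of an entry; the recursion carries this down
   to degree [n + 1], because [c] has no coefficient above that degree. *)
have Dbig k : (n < k)%N -> D k = 0.
  pose m := (\max_(p : 'I_n.+1 * 'I_n.+1) size (D' p.1 p.2))%N.
  have Dm l : (m <= l)%N -> D l = 0.
    move=> ml; apply/matrixP => i j; rewrite [LHS]mxE [RHS]mxE nth_default //.
    apply: (leq_trans _ ml).
    exact: (leq_bigmax (i, j)).
  move=> nk; have : D (k + m)%N = 0 by apply: Dm; rewrite leq_addl.
  elim: m {Dm} => [|m IH]; first by rewrite addn0.
  rewrite addnS => D0; apply: IH; rewrite E' D0 mul0mx add0r nth_default ?raddf0 //.
  by rewrite szc !ltnS (leq_trans nk) // leq_addr.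
have trD k : \tr (D k) = c`_k.+1 *+ k.+1.
  rewrite -coef_deriv deriv_char_poly /mxtrace coef_sum.
  by apply: eq_bigr => i _; rewrite mxE.
have XS m : X ^+ m *m X = X ^+ m.+1 by rewrite exprSr.
have main m : (m <= n)%N -> D (n - m)%N = X ^+ m /\
    forall l, (l < m)%N -> c`_(n - l) = 0.
  elim: m => [_|m IH mn].
    by split=> //; rewrite subn0 E' Dbig // mul0mx add0r c_lead.
  have [Dm cm] := IH (ltnW mn).
  have e : (n - m = (n - m.+1).+1)%N by lia.
  have := E' (n - m.+1)%N; rewrite -e Dm => h.
  have c0 : c`_(n - m) = 0.
    have := congr1 mxtrace h; rewrite trD raddfD /= -e XS trX.
    rewrite add0r mxtrace_scalar => /eqP; rewrite eq_sym -subr_eq0 -mulrnBr; last lia.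
    have -> : (n.+1 - (n - m) = m.+1)%N by lia.
    by move/eqP/R_torsion_free.
  split; first by rewrite h c0 raddf0 addr0 XS.
  by move=> l; rewrite ltnS leq_eqVlt => /orP [/eqP -> //|/cm].
(* [main] only reaches the coefficients of degree 1 to [n]; the constant one comes from the last
   equation, [E0]. *)
have c00 : c`_0 = 0.
  have [D0 _] := main n (leqnn n); rewrite subnn in D0.
  have := congr1 mxtrace E0; rewrite D0 raddfN /= XS trX oppr0.
  by rewrite mxtrace_scalar => /esym/R_torsion_free.
split; last first.
  move=> k i j kn; have [] := main (n - k)%N (leq_subr _ _).
  by rewrite subKn // => /matrixP/(_ i j); rewrite mxE.
apply/polyP => k; rewrite coefXn; have [->//|kn1] := eqVneq k n.+1.
have [kn|kn] := ltnP k n.+1; last by rewrite nth_default // szc ltn_neqAle eq_sym kn1.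
case: k kn {kn1} => // k kn.
have [_ /(_ (n - k.+1)%N)] := main n (leqnn n).
by rewrite subKn //; apply; lia.
Qed.

Lemma traceless_power_symmetry n (X : 'M[R]_n.+1) p r s q :
    (forall k, \tr (X ^+ k.+1) = 0) ->
  \sum_(i < n.+1) (X ^+ (n - i)) p r * (X ^+ i) s q =
  \sum_(i < n.+1) (X ^+ (n - i)) s r * (X ^+ i) p q.
Proof.
move=> trX; have [cX Dk] := adj_char_poly_mx_traceless trX.
have [z] := adj_minor2 (char_poly_mx X) p r s q.
rewrite -[\det _]/(char_poly X) cX => /(congr1 (fun f : {poly R} => f`_n)).
(* The minor is a multiple of ['X^n.+1], so its coefficient of degree [n] is zero. *)
rewrite coefXnM ltnS leqnn coefB => /eqP; rewrite subr_eq0 !coefM => /eqP h.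
have {}h := etrans (etrans _ h) _; apply: h; apply: eq_bigr => i _;
  by rewrite !Dk ?leq_subr ?leq_ord // subKn // leq_ord.
Qed.
End Commutative.

(** * The exterior algebra as a ring *)

Section Sign.
Variable T : finType.
Implicit Types A B C S : {set T}.

Definition inversions A B : {set T * T} :=
  [set p : T * T | [&& p.1 \in A, p.2 \in B & (enum_rank p.2 < enum_rank p.1)%N]].

Lemma ext_sign0l B : ext_sign set0 B = 1.
Proof.
by rewrite /ext_sign (_ : [set _ | _] = set0) ?cards0 //; apply/setP => p; rewrite !inE.
Qed.

Lemma ext_sign0r A : ext_sign A set0 = 1.
Proof.
rewrite /ext_sign (_ : [set _ | _] = set0) ?cards0 //.
by apply/setP => p; rewrite !inE andbF.
Qed.

Lemma ext_signUl A B C : [disjoint A & B] ->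
  ext_sign (A :|: B) C = ext_sign A C * ext_sign B C.
Proof.
move=> dAB; rewrite /ext_sign -!/(inversions _ _) -exprD.
have -> : inversions (A :|: B) C = inversions A C :|: inversions B C.
  by apply/setP => p; rewrite !inE andb_orl.
rewrite cardsU (_ : _ :&: _ = set0) ?cards0 ?subn0 //.
apply/setP => p; rewrite !inE; case pA: (p.1 \in A) => //=.
by rewrite (disjointFr dAB pA) /= andbF.
Qed.

Lemma ext_signUr A B C : [disjoint B & C] ->
  ext_sign A (B :|: C) = ext_sign A B * ext_sign A C.
Proof.
move=> dBC; rewrite /ext_sign -!/(inversions _ _) -exprD.
have -> : inversions A (B :|: C) = inversions A B :|: inversions A C.
  by apply/setP => p; rewrite !inE andb_orl andb_orr.
rewrite cardsU (_ : _ :&: _ = set0) ?cards0 ?subn0 //.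
apply/setP => p; rewrite !inE; case pB: (p.2 \in B); last by rewrite /= andbF.
by rewrite (disjointFr dBC pB) /= !andbF.
Qed.

(** Each pair of [A x B] is an inversion in exactly one of the two orders, so the two inversion
    counts add up to [#|A| * #|B|]. *)
Lemma ext_signC A B : [disjoint A & B] ->
  ext_sign B A = (-1) ^+ (#|A| * #|B|) * ext_sign A B.
Proof.
move=> dAB; rewrite /ext_sign -!/(inversions _ _).
have <- : (#|inversions A B| + #|inversions B A| = #|A| * #|B|)%N.
  pose sw (p : T * T) := (p.2, p.1).
  have swI : injective sw by move=> [a b] [c d] [-> ->].
  rewrite -(card_imset (inversions B A) swI) -cardsX -cardsUI.
  rewrite (_ : _ :&: _ = set0) ?cards0 ?addn0.
    apply: eq_card => -[a b]; rewrite !inE /=.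
    apply/orP/andP => [[/and3P[-> ->] //|/imsetP[[c d]]]|[aA bB]].
      by rewrite inE /= => /and3P[cB dA _] [-> ->].
    case: (ltngtP (enum_rank a) (enum_rank b)) => [h|h|/ord_inj/enum_rank_inj h].
    - by right; apply/imsetP; exists (b, a) => //; rewrite inE /= aA bB.
    - by left; rewrite aA bB.
    - by rewrite -h (disjointFr dAB aA) in bB.
  apply/setP => -[a b]; rewrite !inE /=; apply/negP => /andP[/and3P[aA bB h]].
  by case/imsetP=> [[c d]]; rewrite inE /= => /and3P[_ _ h'] [? ?]; subst; lia.
by rewrite exprD mulrAC -exprD addnn -mul2n exprM sqrrN !expr1n mul1r.
Qed.
End Sign.

(* An alias of [ext T] whose ring product is [emul]. *)
Definition exterior (T : finType) : Type := ext T.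

Section Ring.
Variable T : finType.

HB.instance Definition _ := GRing.Zmodule.on (exterior T).

Local Notation E := (exterior T).
Implicit Types f g h : E.

Lemma emul1l : left_id (eone T : E) (@emul T).
Proof.
move=> f; apply/ffunP => S; rewrite ffunE (bigD1 set0) ?sub0set //= big1.
  by rewrite ffunE eqxx setD0 ext_sign0l !mul1r addr0.
by move=> A /andP[_ /negPf A0]; rewrite ffunE A0 mulr0 mul0r.
Qed.

Lemma emul1r : right_id (eone T : E) (@emul T).
Proof.
move=> f; apply/ffunP => S; rewrite ffunE (bigD1 S) //= big1.
  by rewrite ffunE setDv eqxx ext_sign0r mulr1 mul1r addr0.
move=> A /andP[AS nAS]; rewrite ffunE setD_eq0 (_ : (S \subset A) = false) ?mulr0 //.
by apply: contraNF nAS => SA; rewrite eqEsubset AS.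
Qed.

Lemma emulDl : left_distributive (@emul T : E -> E -> E) +%R.
Proof.
move=> f g h; apply/ffunP => S; rewrite !ffunE -big_split /=.
by apply: eq_bigr => A _; rewrite !ffunE mulrDr mulrDl.
Qed.

Lemma emulDr : right_distributive (@emul T : E -> E -> E) +%R.
Proof.
move=> f g h; apply/ffunP => S; rewrite !ffunE -big_split /=.
by apply: eq_bigr => A _; rewrite !ffunE mulrDr.
Qed.

(** Both sides are sums over chains [A \subset C \subset S], that is, over splittings of [S] into
    [A], [C :\: A] and [S :\: C]. The signs agree because [ext_sign] is multiplicative in each
    argument over disjoint unions. *)
Lemma emulA : associative (@emul T : E -> E -> E).
Proof.
move=> f g h; apply/ffunP => S; rewrite !ffunE.
transitivity (\sum_(A : {set T} | A \subset S) \sum_(C : {set T} | (A \subset C) && (C \subset S))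
   ext_sign A (S :\: A) * ext_sign (C :\: A) (S :\: C) * f A * g (C :\: A) * h (S :\: C)).
  apply: eq_bigr => A AS; rewrite ffunE mulr_sumr.
  (* A subset [B] of [S :\: A] is replaced by [C = A :|: B]. *)
  rewrite (reindex_onto (fun C => C :\: A) (fun B => A :|: B)) /=; last first.
    move=> B /subsetP BS; apply/setP => x; rewrite !inE.
    by case xA: (x \in A) => //=; apply/esym/negP => /BS; rewrite !inE xA.
  apply: eq_big => [C|C /andP[_ /eqP eC]].
    have -> : A :|: C :\: A = A :|: C by rewrite setDE setUIr setUCr setIT.
    apply/andP/andP => [[CS /eqP/setUidPr sAC]|[sAC CS]]; split=> //.
      by rewrite -(setID C A) subUset (subset_trans (subsetIr _ _) AS) (subset_trans CS) ?subsetDl.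
      by rewrite setSD.
    by apply/eqP/setUidPr.
  rewrite setDDl -setDDl setDDl.
  by rewrite eC !mulrA; congr (_ * _ * _); rewrite mulrAC.
rewrite (exchange_big_dep (fun C : {set T} => C \subset S)) /=; last by move=> A C _ /andP[].
apply: eq_bigr => C CS; rewrite ffunE mulr_sumr mulr_suml.
apply: eq_big => [A|A /and3P[AS sAC _]].
  by rewrite CS andbT; case sAC: (A \subset C); rewrite ?andbF // (subset_trans sAC).
rewrite !mulrA; congr (_ * _ * _ * _).
have -> : S :\: A = (C :\: A) :|: (S :\: C).
  apply/setP => x; rewrite !inE; case xA: (x \in A) => /=.
    by rewrite (subsetP sAC).
  by case xC: (x \in C) => //=; rewrite (subsetP CS).
rewrite ext_signUr; last first.
  by rewrite -setI_eq0; apply/eqP/setP => x; rewrite !inE; case: (x \in C); rewrite ?andbF.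
have <- : ext_sign (A :|: (C :\: A)) (S :\: C) = ext_sign C (S :\: C).
  by congr ext_sign; rewrite setDE setUIr setUCr setIT; apply/setUidPr.
rewrite ext_signUl; last first.
  by rewrite -setI_eq0; apply/eqP/setP => x; rewrite !inE; case: (x \in A); rewrite ?andbF.
by rewrite -mulrA mulrC.
Qed.

Lemma eone_neq0 : (eone T : E) != 0.
Proof. by apply/eqP => /ffunP/(_ set0)/eqP; rewrite !ffunE eqxx oner_eq0. Qed.

HB.instance Definition _ := GRing.Zmodule_isNzRing.Build (exterior T)
  emulA emul1l emul1r emulDl emulDr eone_neq0.

(** Homogeneity for the grading modulo 2: [true] stands for odd, [false] for even, and zero has both
    parities. *)
Definition homogeneous (b : bool) : {pred E} :=
  fun f => [forall S : {set T}, (f S != 0) ==> (odd #|S| == b)].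

Lemma homogeneousP b f :
  reflect (forall S : {set T}, odd #|S| != b -> f S = 0) (f \in homogeneous b).
Proof.
apply: (iffP forallP) => H S.
  by move=> Sb; apply: contraTeq (H S) => fS; rewrite fS (negPf Sb).
by apply/implyP; apply: contraNT => /H ->.
Qed.

Lemma homogeneousM b c f g : f \in homogeneous b -> g \in homogeneous c ->
  f * g \in homogeneous (b (+) c).
Proof.
move=> /homogeneousP Hf /homogeneousP Hg; apply/homogeneousP => S Sbc.
rewrite ffunE big1 // => A AS.
have [eb|nb] := eqVneq (odd #|A|) b; last by rewrite (Hf A) // mulr0 mul0r.
rewrite (Hg (S :\: A)) ?mulr0 //; apply: contraNneq Sbc => <-.
by rewrite -eb -oddD cardsD (setIidPr AS) subnKC // subset_leq_card.
Qed.

(** Exchanging [A] with its complement in [S] matches the terms of the two products. In a nonzero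
    term the two sets have parities [b] and [c], so [ext_signC] yields the same sign for all of
    them. *)
Lemma homogeneousC b c f g : f \in homogeneous b -> g \in homogeneous c ->
  g * f = (-1) ^+ (b && c) * (f * g).
Proof.
move=> /homogeneousP Hf /homogeneousP Hg.
suff H S : (g * f) S = (-1) ^+ (b && c) * (f * g) S.
  by apply/ffunP => S; rewrite H !mulr_sign; case: (b && c); rewrite ?ffunE.
rewrite !ffunE mulr_sumr.
rewrite (reindex_onto (fun A => S :\: A) (fun A => S :\: A)) /=; last first.
  by move=> A AS; rewrite setDDr setDv set0U; apply/setIidPr.
apply: eq_big => [A|A /andP[_ /eqP eA]].
  by rewrite subsetDl setDDr setDv set0U; apply/eqP/idP => /setIidPr.
rewrite eA.
have [eb|nb] := eqVneq (odd #|A|) b; last by rewrite (Hf A) // !mulr0 mul0r mulr0.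
have [ec|nc] := eqVneq (odd #|S :\: A|) c; last by rewrite (Hg (_ :\: A)) // !mulr0 mul0r.
rewrite (@ext_signC _ A); last first.
  by rewrite -setI_eq0; apply/eqP/setP => x; rewrite !inE; case: (x \in A); rewrite ?andbF.
by rewrite -signr_odd oddM eb ec !mulrA mulrAC.
Qed.

Lemma homogeneous_zmod_closed b : zmod_closed (homogeneous b).
Proof.
split; first by apply/homogeneousP => S _; rewrite ffunE.
move=> f g /homogeneousP Hf /homogeneousP Hg; apply/homogeneousP => S Sb.
by rewrite !ffunE Hf // Hg // subrr.
Qed.

HB.instance Definition _ b :=
  GRing.isZmodClosed.Build E (homogeneous b) (homogeneous_zmod_closed b).

Lemma even_subring_closed : subring_closed (homogeneous false).
Proof.
split; [|exact: rpredB|by move=> f g; apply: homogeneousM].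
by apply/homogeneousP => S; rewrite ffunE; case: (eqVneq S) => // ->; rewrite cards0.
Qed.

Lemma egen_odd (t : T) : (egen t : E) \in homogeneous true.
Proof. by apply/homogeneousP => S; rewrite ffunE; case: (eqVneq S) => // ->; rewrite cards1. Qed.

Lemma exterior_torsion_free f k : f *+ k.+1 = 0 -> f = 0.
Proof.
move=> H; apply/ffunP => S; move/ffunP/(_ S): H.
have -> : (f *+ k.+1) S = f S *+ k.+1 by elim: k.+1 => [|m IH]; rewrite ?ffunE // !mulrS ffunE IH.
by move/eqP; rewrite ffunE mulrn_eq0 => /eqP.
Qed.
End Ring.

(** The even elements form a commutative ring; as a type of their own they admit the determinants
    and characteristic polynomials above. *)
Definition even_ext (T : finType) := {f : exterior T | f \in homogeneous false}.
Section EvenRing.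
Variable T : finType.
HB.instance Definition _ := SubType.on (even_ext T).
HB.instance Definition _ := Choice.on (even_ext T).
HB.instance Definition _ := GRing.SubChoice_isSubNzRing.Build _ _ (even_ext T) (@even_subring_closed T).
Lemma even_ext_mulC : commutative (@GRing.mul (even_ext T)).
Proof.
move=> f g; apply: val_inj; rewrite !rmorphM /=.
by rewrite (homogeneousC (valP f) (valP g)) mul1r.
Qed.
HB.instance Definition _ := GRing.PzRing_hasCommutativeMul.Build (even_ext T) even_ext_mulC.

Lemma even_ext_torsion_free (f : even_ext T) k : f *+ k.+1 = 0 -> f = 0.
Proof.
move/(congr1 val); rewrite raddfMn raddf0 => /exterior_torsion_free f0.
by apply: val_inj; rewrite f0 raddf0.
Qed.
End EvenRing.

(** * Matrices with odd entries *)

Section OddMatrices.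
Variables (T : finType) (n : nat).

Definition homogeneous_mx (b : bool) (M : 'M[exterior T]_n) :=
  forall i j, M i j \in homogeneous b.

Lemma homogeneous_mulmx b c M N : homogeneous_mx b M -> homogeneous_mx c N ->
  homogeneous_mx (b (+) c) (M *m N).
Proof.
by move=> hM hN i j; rewrite mxE rpred_sum // => k _; apply: homogeneousM.
Qed.

(** Transposition reverses the product, and restoring the order of the entries costs the sign of
    graded commutativity. *)
Lemma tr_homogeneous_mulmx b c M N : homogeneous_mx b M -> homogeneous_mx c N ->
  (M *m N)^T = (-1) ^+ (b && c) *: (N^T *m M^T).
Proof.
move=> hM hN; apply/matrixP => i j; rewrite !mxE mulr_sumr.
by apply: eq_bigr => k _; rewrite !mxE andbC; apply: homogeneousC.
Qed.

(** Swapping the two summation indices turns the trace into its negative while the factors keep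
    their order; then 2 is cancelled. *)
Lemma trace_skew_sym (P Q : 'M[exterior T]_n) : P^T = - P -> Q^T = Q -> \tr (P *m Q) = 0.
Proof.
move=> hP hQ; apply: (@exterior_torsion_free _ _ 1).
rewrite mulr2n -{1}hQ -[in X in X + _](opprK P) -hP mulNmx raddfN /=.
apply/eqP; rewrite addrC subr_eq0; apply/eqP.
rewrite /mxtrace.
under eq_bigr do rewrite mxE.
under [RHS]eq_bigr do rewrite mxE.
rewrite exchange_big; apply: eq_bigr => i _; apply: eq_bigr => j _.
by rewrite !mxE.
Qed.
End OddMatrices.

(** * Alternating words in a skew-symmetric and a symmetric odd matrix *)

Section OddSkewSym.
Variables (T : finType) (n : nat) (A B : 'M[exterior T]_n.+1).
Hypotheses (oddA : homogeneous_mx true A) (oddB : homogeneous_mx true B).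
Hypotheses (skewA : A^T = - A) (symB : B^T = B).

Lemma odd_alternating_word k : homogeneous_mx true ((A *m B) ^+ k *m A).
Proof.
elim: k => [|k IH]; first by rewrite expr0 mul1mx.
rewrite exprS -mulmxA; apply: (@homogeneous_mulmx _ _ false true) => //.
exact: (@homogeneous_mulmx _ _ true true).
Qed.

(* Reversing a word of three odd factors changes its sign. *)
Lemma tr_alternating_word k : ((A *m B) ^+ k *m A)^T = - ((A *m B) ^+ k *m A).
Proof.
elim: k => [|k IH]; first by rewrite expr0 mul1mx.
have oddP := odd_alternating_word k.
rewrite {1}exprS -2!mulmxA (tr_homogeneous_mulmx oddA (homogeneous_mulmx oddB oddP)).
rewrite (tr_homogeneous_mulmx oddB oddP) IH skewA symB expr0 expr1.
by rewrite scale1r scaleN1r mulmxN !mulNmx !opprK exprSr -mulmxE !mulmxA.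
Qed.

Lemma alternating_word_eq0 : (A *m B) ^+ n *m A = 0.
Proof.
have evenX i j : (A *m B) i j \in homogeneous false.
  exact: (homogeneous_mulmx oddA oddB).
(* [X] is [A *m B] read over the commutative ring of even elements. *)
pose X : 'M[even_ext T]_n.+1 := \matrix_(i, j) (exist (fun f => f \in homogeneous false) _ (evenX i j) : even_ext T).
have XE k : map_mx val (X ^+ k) = (A *m B) ^+ k.
  by rewrite rmorphXn; congr (_ ^+ _); apply/matrixP => i j; rewrite !mxE.
have XkE k i j : val ((X ^+ k) i j) = ((A *m B) ^+ k) i j by rewrite -XE mxE.
have trX k : \tr (X ^+ k.+1) = 0.
  apply: val_inj; rewrite -trace_map_mx XE exprSr -mulmxE mulmxA.
  by rewrite (trace_skew_sym (tr_alternating_word k) symB) raddf0.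
have sym p r s q := congr1 val
  (traceless_power_symmetry (@even_ext_torsion_free T) p r s q trX).
have skewP k r s : ((A *m B) ^+ k *m A) r s = - ((A *m B) ^+ k *m A) s r.
  by move/matrixP/(_ s r): (tr_alternating_word k); rewrite mxE [RHS]mxE.
(* The odd entry [A r l] stays on the right, so no factors are exchanged. Each of the [n.+1] values
   of [i] contributes the same word. *)
have contract p s : \sum_r \sum_l (\sum_(i < n.+1)
    ((A *m B) ^+ (n - i)) p r * ((A *m B) ^+ i) s l) * A r l
    = ((A *m B) ^+ n *m A) p s *+ n.+1.
  transitivity (\sum_(i < n.+1) ((A *m B) ^+ n *m A) p s); last first.
    by rewrite sumr_const card_ord.
  under eq_bigr do (under eq_bigr do rewrite mulr_suml; rewrite exchange_big).
  rewrite exchange_big; apply: eq_bigr => i _ /=.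
  have -> : (A *m B) ^+ n *m A = (A *m B) ^+ (n - i) *m ((A *m B) ^+ i *m A).
    rewrite mulmxA; congr (_ *m _).
    by have := exprD (A *m B) (n - i) i; rewrite subnK // leq_ord.
  rewrite [RHS]mxE; apply: eq_bigr => r _.
  (* Skewness is used twice, for the word [(A *m B) ^+ i *m A] and for [A] itself, and the two signs
     cancel. *)
  rewrite skewP [(_ *m A) s r]mxE -sumrN mulr_sumr; apply: eq_bigr => l _.
  rewrite -mulrA; congr (_ * _); rewrite -mulrN; congr (_ * _).
  by move/matrixP/(_ l r): skewA; rewrite !mxE.
apply/matrixP => p s; rewrite [RHS]mxE.
have E : ((A *m B) ^+ n *m A) p s *+ n.+1 = ((A *m B) ^+ n *m A) s p *+ n.+1.
  rewrite -!contract; apply: eq_bigr => r _; apply: eq_bigr => l _; congr (_ * _).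
  have := sym p r s l; rewrite !raddf_sum /= => h.
  have {}h := etrans (etrans _ h) _; apply: h; apply: eq_bigr => i _;
    by rewrite -!XkE.
(* The entry is both symmetric, up to the factor [n.+1], and skew; it remains to cancel 2 and
   [n.+1]. *)
apply: (@exterior_torsion_free _ _ 1); apply: (@exterior_torsion_free _ _ n).
by rewrite -mulrnA mulnC mulrnA mulr2n {1}E skewP mulNrn addNr.
Qed.
End OddSkewSym.

(** * Passage from the coordinate definitions to the ring structure *)

Lemma emulmxE (T : finType) n (M N : 'M[exterior T]_n) : emulmx M N = M *m N.
Proof. by apply/matrixP => i j; rewrite !mxE. Qed.

Lemma epowmxE (T : finType) n (M : 'M[exterior T]_n.+1) k : epowmx M k = M ^+ k.
Proof.
elim: k => [|k IH].
  by apply/matrixP => i j; rewrite !mxE; case: eqP.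
by rewrite /epowmx iterS -/(epowmx M k) IH exprS -mulmxE -emulmxE.
Qed.

Lemma a_entry_odd n (i j : 'I_n) : (a_entry i j : exterior _) \in homogeneous true.
Proof.
rewrite /a_entry; case: ltnP => // h; first exact: egen_odd.
by case: ltnP => // h'; rewrite ?rpred0 // rpredN egen_odd.
Qed.

Lemma b_entry_odd n (i j : 'I_n) : (b_entry i j : exterior _) \in homogeneous true.
Proof.
rewrite /b_entry; case: leqP => h; last exact: egen_odd.
by case: eqP => // _; rewrite ?scaler_nat ?rpredMn // egen_odd.
Qed.

Lemma a_entryC n (i j : 'I_n) : a_entry j i = - a_entry i j.
Proof.
rewrite /a_entry; case: (ltnP j i) => h; case: (ltnP i j) => h'; rewrite ?oppr0 ?opprK //.
by have := ltn_trans h h'; rewrite ltnn.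
Qed.

Lemma b_entryC n (i j : 'I_n) : b_entry j i = b_entry i j.
Proof.
have [-> //|ij] := eqVneq i j.
rewrite /b_entry [j == i]eq_sym (negPf ij).
case: (leqP j i) => h; case: (leqP i j) => h'.
- by case/eqP: ij; apply/val_inj/eqP; rewrite eqn_leq h h'.
(* Both sides name the same sorted pair and differ only in the proof that it is sorted. *)
- by congr (egen (inr _)); apply: val_inj.
- by congr (egen (inr _)); apply: val_inj.
- by have := ltn_trans h h'; rewrite ltnn.
Qed.

Theorem theorem5p5 (n : nat) :
  emulmx (epowmx (emulmx (Amx n) (Bmx n)) n.-1) (Amx n) = 0.
Proof.
(* For size 0 the matrices have no entries; otherwise the exponent [n.+1.-1] is [n]. *)
case: n => [|n]; first by apply/matrixP => -[].
rewrite [LHS]emulmxE epowmxE emulmxE.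
apply: alternating_word_eq0; first 1 last.
- by move=> i j; rewrite mxE b_entry_odd.
- by apply/matrixP => i j; rewrite !mxE a_entryC.
- by apply/matrixP => i j; rewrite !mxE b_entryC.
- by move=> i j; rewrite mxE a_entry_odd.
Qed.
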